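(* Let $n\geq 2$ and let $G=Q_{4n}$ be the generalized quaternion group of order $4n$. Let $i,j\in\mathbb{Z}$ with $a^i\notin Z(G)$ (so that $C_G(a^i)=\langle a\rangle$), and let $\chi_j$ be the irreducible character of $\langle a\rangle$ given by $\chi_j(a)=\mu_{2n}^j$, where $\mu_{2n}$ is any fixed primitive $2n$-th root of unity. Then the irreducible $\mathcal{D}(Q_{4n})$-module $V=M(\mathrm{class}(a^i),\chi_j)$ has, for every $m\in\mathbb{N}$, $$\nu_m(V)=\begin{cases} 2 & \text{if } 2\mid m,\ 4\mid mj,\ 2n\mid mi,\ 2n\mid mj,\\ 1 & \text{if } (2\nmid m,\ 2n\mid mi,\ 2n\mid mj) \text{ or } (2\mid m,\ 4\mid mj,\ (2n\nmid mi \text{ or } 2n\nmid mj)),\\ 0 & \text{if } (2\nmid m,\ (2n\nmid mi \text{ or } 2n\nmid mj)) \text{ or } (2\mid m,\ 4\nmid mj,\ 2n\mid mi,\ 2n\mid mj),\\ -1 & \text{if } 2\mid m,\ 4\nmid mj,\ (2n\nmid mi \text{ or } 2n\nmid mj).\end{cases}$$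
   Context: $\mathbb{N}=\{1,2,3,\dots\}$. For $2\leq n\in\mathbb{N}$, $Q_{4n}=\langle a,b\mid a^{2n}=1,\ b^2=a^n,\ bab^{-1}=a^{-1}\rangle$. For a finite group $G$, the Drinfel'd double $\mathcal{D}(G)$ is the complex Hopf algebra with basis $\{p_g\bowtie x : g,x\in G\}$, multiplication $(p_g\bowtie x)(p_h\bowtie y)=\delta_{g,xhx^{-1}}\,p_g\bowtie xy$, unit $\sum_g p_g\bowtie 1$, comultiplication $\Delta(p_g\bowtie x)=\sum_{uv=g}(p_u\bowtie x)\otimes(p_v\bowtie x)$ and counit $\epsilon(p_g\bowtie x)=\delta_{g,1}$. Its integral with counit value 1 is $\Lambda=\frac{1}{|G|}\sum_{x\in G}p_1\bowtie x$. Put $\Lambda^{[m]}=\sum\Lambda_1\Lambda_2\cdots\Lambda_m$ (the product of the $m$ tensor factors of the iterated comultiplication of $\Lambda$). For a finite-dimensional $\mathcal{D}(G)$-module $V$ with character $\chi$, the $m$-th indicator is $\nu_m(V)=\chi(\Lambda^{[m]})$. For $t\in G$ and an irreducible representation (or its character) $\rho$ of $C_G(t)$ on a space $W$, the irreducible module $M(\mathrm{class}(t),\rho)$ is defined as follows. Write $\mathrm{class}(t)=\{t_1,\dots,t_N\}$ for the conjugacy class and $t_i=g_itg_i^{-1}$. Then $M(\mathrm{class}(t),\rho)=\bigoplus_{i=1}^N g_i\otimes W$, with $p_h\bowtie 1$ acting by $g_i\otimes w\mapsto\delta_{h,t_i}\,g_i\otimes w$, and $x\in G$ acting by $g_i\otimes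 w\mapsto g_j\otimes\rho(\gamma)w$ where $xg_i=g_j\gamma$ with $\gamma\in C_G(t)$. *)

(* Defs.v *)
From HB Require Import structures.
From mathcomp Require Import all_boot all_order all_fingroup all_algebra.
From mathcomp Require Import mxrepresentation.
From mathcomp Require Import ring.

Set Implicit Arguments.
Unset Strict Implicit.
Unset Printing Implicit Defensive.

Import GRing.Theory.

Local Open Scope ring_scope.

Definition expgz (gT : finGroupType) (x : gT) (k : int) : gT :=
  match k with
  | Posz n => (x ^+ n)%g
  | Negz n => (x ^- n.+1)%g
  end.

(* [set: gT] is the group < x, y | x^(2n), y^2 = x^n, y x y^-1 = x^-1 >, and
   a, b generate it subject to these relations. Grp (...) denotes the largest
   finite quotient of the presented group, which here is the presented group
   itself since the latter has order 4n; as [set: gT] is finite, a and b then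
   are the images of x and y under some isomorphism. *)
Definition generalized_quaternion (n : nat) (gT : finGroupType) (a b : gT) :=
  [/\ [set: gT] \isog Grp (x : y :
        x ^+ (2 * n), y ^+ 2 = x ^+ n, y * x * y^-1 = x^-1)%g,
      <<[set a; b]>>%g = [set: gT],
      (a ^+ (2 * n) = 1)%g, (b ^+ 2 = a ^+ n)%g & (b * a * b^-1 = a^-1)%g].

Section FreeModule.
Variables (C : fieldType) (I : finType).

Definition fdelta (i : I) : {ffun I -> C^o} := [ffun k => (k == i)%:R].

Lemma fdelta_sum (f : {ffun I -> C^o}) : f = \sum_i f i *: fdelta i.
Proof.
apply/ffunP=> k; rewrite sum_ffunE (bigD1 k) //= big1 => [|i ik].
  by rewrite addr0 !ffunE eqxx /GRing.scale /= mulr1.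
by rewrite !ffunE eq_sym (negPf ik) scaler0.
Qed.

End FreeModule.
Arguments fdelta C {I} i.

(* The Drinfel'd double D(G) for G = [set: gT]; the pair (g, x) is the index of
   the basis vector p_g |><| x. This is not {ffun gT * gT -> C} with its
   pointwise product, hence the alias. *)
Definition drinfeld (C : fieldType) (gT : finGroupType) : Type :=
  {ffun gT * gT -> C^o}.
HB.instance Definition _ (C : fieldType) (gT : finGroupType) :=
  Vector.copy (drinfeld C gT) {ffun gT * gT -> C^o}.

Section Drinfeld.
Variables (C : fieldType) (gT : finGroupType).
Local Notation D := (drinfeld C gT).
Local Notation B := (gT * gT)%type.
Implicit Types (f h k : D) (u v w : B).

Definition dcoef f u : C := (f : {ffun B -> C^o}) u.

Definition dbasis u : D := fdelta C u.

Definition dbasis_mul u v : D :=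
  if u.1 == (u.2 * v.1 * u.2^-1)%g then dbasis (u.1, u.2 * v.2)%g else 0.

Definition dunit : D := \sum_(g : gT) dbasis (g, 1%g).

Definition dmul f h : D :=
  \sum_u \sum_v (dcoef f u * dcoef h v) *: dbasis_mul u v.

Lemma dcoefD f h u : dcoef (f + h) u = dcoef f u + dcoef h u.
Proof. exact: ffunE. Qed.

Lemma dcoefZ c f u : dcoef (c *: f) u = c * dcoef f u.
Proof. exact: ffunE. Qed.

Lemma dcoef_basis u v : dcoef (dbasis u) v = (v == u)%:R.
Proof. exact: ffunE. Qed.

Lemma dcoef0 u : dcoef 0 u = 0.
Proof. exact: ffunE. Qed.

Lemma dbasis_sum f : f = \sum_u dcoef f u *: dbasis u.
Proof. exact: fdelta_sum. Qed.

Lemma dmulDl : left_distributive dmul +%R.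
Proof.
move=> f h k; rewrite /dmul -big_split; apply: eq_bigr => u _.
rewrite -big_split; apply: eq_bigr => v _.
by rewrite dcoefD mulrDl scalerDl.
Qed.

Lemma dmulDr : right_distributive dmul +%R.
Proof.
move=> k f h; rewrite /dmul -big_split; apply: eq_bigr => u _.
rewrite -big_split; apply: eq_bigr => v _.
by rewrite dcoefD mulrDr scalerDl.
Qed.

Lemma dmulZl c f h : dmul (c *: f) h = c *: dmul f h.
Proof.
rewrite /dmul scaler_sumr; apply: eq_bigr => u _.
rewrite scaler_sumr; apply: eq_bigr => v _.
by rewrite dcoefZ scalerA mulrA.
Qed.

Lemma dmulZr c f h : dmul f (c *: h) = c *: dmul f h.
Proof.
rewrite /dmul scaler_sumr; apply: eq_bigr => u _.
rewrite scaler_sumr; apply: eq_bigr => v _.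
by rewrite dcoefZ scalerA mulrCA.
Qed.

Lemma dmul0l f : dmul 0 f = 0.
Proof. by rewrite -(scale0r (0 : D)) dmulZl !scale0r. Qed.

Lemma dmul0r f : dmul f 0 = 0.
Proof. by rewrite -(scale0r (0 : D)) dmulZr !scale0r. Qed.

Lemma dmul_basis u v : dmul (dbasis u) (dbasis v) = dbasis_mul u v.
Proof.
rewrite /dmul (bigD1 u) //= [X in _ + X]big1 ?addr0 => [|u' /negPf nu].
  rewrite (bigD1 v) //= big1 ?addr0 => [|v' /negPf nv].
    by rewrite !dcoef_basis !eqxx mulr1 scale1r.
  by rewrite !dcoef_basis nv mulr0 scale0r.
by rewrite big1 // => v' _; rewrite !dcoef_basis nu mul0r scale0r.
Qed.

Lemma dmul_suml (J : finType) (P : pred J) (F : J -> D) h :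
  dmul (\sum_(j | P j) F j) h = \sum_(j | P j) dmul (F j) h.
Proof.
exact: (big_morph (dmul^~ h) (fun f k => dmulDl f k h) (dmul0l h)).
Qed.

Lemma dmul_sumr (J : finType) (P : pred J) (F : J -> D) h :
  dmul h (\sum_(j | P j) F j) = \sum_(j | P j) dmul h (F j).
Proof. exact: (big_morph (dmul h) (dmulDr h) (dmul0r h)). Qed.

Lemma dbasis_mulA u v w :
  dmul (dbasis u) (dbasis_mul v w) = dmul (dbasis_mul u v) (dbasis w).
Proof.
case: u v w => [g x] [k y] [l z]; rewrite [in LHS]/dbasis_mul.
rewrite [X in _ = dmul X _]/dbasis_mul /=.
have -> : dmul (dbasis (g, x)) (if k == (y * l * y^-1)%g
    then dbasis (k, (y * z)%g) else 0) =
    if (k == y * l * y^-1)%g && (g == x * k * x^-1)%g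
    then dbasis (g, (x * (y * z))%g) else 0.
  by case: (k == _); rewrite ?dmul0r // dmul_basis.
have -> : dmul (if g == (x * k * x^-1)%g then dbasis (g, (x * y)%g) else 0)
    (dbasis (l, z)) =
    if (g == x * k * x^-1)%g && (g == (x * y) * l * (x * y)^-1)%g
    then dbasis (g, ((x * y) * z)%g) else 0.
  by case: (g == (x * k * _)%g); rewrite ?dmul0l // dmul_basis.
rewrite mulgA andbC; case: (altP (g =P _)) => //= ->.
have -> : (x * y * l * (x * y)^-1 = x * (y * l * y^-1) * x^-1)%g.
  by rewrite invMg !mulgA.
by rewrite (inj_eq (mulIg _)) (inj_eq (mulgI _)).
Qed.

Lemma dmulA : associative dmul.
Proof.
have E f h (J : finType) (F : J -> D) : h = \sum_j F j ->
    dmul f h = \sum_j dmul f (F j) by move=> ->; apply: dmul_sumr.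
have E' f h (J : finType) (F : J -> D) : f = \sum_j F j ->
    dmul f h = \sum_j dmul (F j) h by move=> ->; apply: dmul_suml.
move=> f h k; rewrite (E' _ _ _ _ (dbasis_sum f)).
rewrite (E' (dmul f h) _ _ _ (E' _ _ _ _ (dbasis_sum f))).
apply: eq_bigr => u _.
rewrite (E _ _ _ _ (E' _ _ _ _ (dbasis_sum h))).
rewrite (E' _ _ _ _ (E _ _ _ _ (dbasis_sum h))).
apply: eq_bigr => v _.
rewrite (E _ _ _ _ (E _ _ _ _ (dbasis_sum k))) (E _ _ _ _ (dbasis_sum k)).
apply: eq_bigr => w _.
rewrite !(dmulZl, dmulZr) !dmul_basis dbasis_mulA !scalerA.
by congr (_ *: _); ring.
Qed.

Lemma dmul1l : left_id dunit dmul.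
Proof.
move=> f; rewrite {1}(dbasis_sum f) dmul_sumr [RHS]dbasis_sum.
apply: eq_bigr => u _; rewrite dmulZr /dunit dmul_suml (bigD1 u.1) //=.
rewrite big1 ?addr0 => [|g /negPf ng]; rewrite dmul_basis /dbasis_mul /=.
  by rewrite invg1 mulg1 !mul1g eqxx -surjective_pairing.
by rewrite invg1 mulg1 mul1g ng.
Qed.

Lemma dmul1r : right_id dunit dmul.
Proof.
move=> f; rewrite {1}(dbasis_sum f) dmul_suml [RHS]dbasis_sum.
apply: eq_bigr => u _; rewrite dmulZl /dunit dmul_sumr.
rewrite (bigD1 (u.2^-1 * u.1 * u.2)%g) //=.
rewrite big1 ?addr0 => [|g /negPf ng]; rewrite dmul_basis /dbasis_mul /=.
  by rewrite !mulgA mulgV mul1g mulgK eqxx mulg1 -surjective_pairing.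
case: (altP (u.1 =P _)) ng => // ->.
by rewrite !mulgA mulVg mul1g mulgKV eqxx.
Qed.

Lemma dunit_neq0 : dunit != 0.
Proof.
apply/eqP=> /(congr1 (fun f => dcoef f (1, 1)%g)).
rewrite /dunit dcoef0 (bigD1 1%g) //= dcoefD dcoef_basis eqxx.
have -> : dcoef (\sum_(g | g != 1%g) dbasis (g, 1%g)) (1, 1)%g = 0.
  rewrite (big_morph (dcoef^~ (1, 1)%g) (fun f h => dcoefD f h _) (dcoef0 _)).
  apply: big1 => g /negPf ng.
  by rewrite dcoef_basis -pair_eqE /pair_eq /= eq_sym ng.
by move/eqP; rewrite addr0 oner_eq0.
Qed.

HB.instance Definition _ := GRing.Zmodule_isNzRing.Build D
  dmulA dmul1l dmul1r dmulDl dmulDr dunit_neq0.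

HB.instance Definition _ := GRing.Lmodule_isLalgebra.Build C D
  (fun c f h => esym (dmulZl c f h)).

HB.instance Definition _ := GRing.Lalgebra_isAlgebra.Build C D
  (fun c f h => esym (dmulZr c f h)).

Definition dcounit f : C := \sum_u dcoef f u * (u.1 == 1%g)%:R.

(* D (x) D is the space with basis B * B, and the sum over uv runs over the
   factorisations of g in p_g |><| x, for w = (g, x). *)
Definition dcomul f : {ffun B * B -> C^o} :=
  \sum_w dcoef f w *:
    \sum_(uv : gT * gT | (uv.1 * uv.2 == w.1)%g)
       fdelta C ((uv.1, w.2), (uv.2, w.2)).

(* The iterated comultiplication D -> D^(x)m, where D^(x)m is the space with
   basis m.-tuple B: the counit for m = 0 and (id (x) iter_comul m) \o dcomul
   for m.+1. *)
Fixpoint iter_comul m f : {ffun m.-tuple B -> C^o} :=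
  match m with
  | 0 => [ffun=> dcounit f]
  | m'.+1 => [ffun s : m'.+1.-tuple B =>
      iter_comul m' ([ffun v => dcomul f (thead s, v)] : {ffun B -> C^o})
        [tuple of behead s]]
  end.

Definition tensor_mul m (T : {ffun m.-tuple B -> C^o}) : D :=
  \sum_(s : m.-tuple B) T s *: \prod_(u <- s) dbasis u.

Definition sweedler_power m f : D := tensor_mul (iter_comul m f).

Definition dintegral : D := #|gT|%:R^-1 *: \sum_(x : gT) dbasis (1%g, x).

Record dmodule := DModule {
  dmod_sort :> vectType C;
  dmod_act : D -> 'End(dmod_sort);
  dmod_linear : linear dmod_act;
  dmod_act1 : dmod_act 1 = \1%VF;
  dmod_actM : forall f h, dmod_act (f * h) = (dmod_act f \o dmod_act h)%VF
}.

Definition dcharacter (V : dmodule) f : C :=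
  let e := vbasis {:V} in \tr (passmx.mxof e e (dmod_act V f)).

Definition indicator m (V : dmodule) : C :=
  dcharacter V (sweedler_power m dintegral).

End Drinfeld.

Record class_reps (gT : finGroupType) (t : gT) := ClassReps {
  creps_size : nat;
  creps :> 'I_creps_size -> gT;
  creps_inj : injective (fun i => creps i * t * (creps i)^-1)%g;
  creps_onto : [set (creps i * t * (creps i)^-1)%g | i in 'I_creps_size]
                 = (t ^: [set: gT])%g
}.

(* g_i (x) w is represented by the function with value w at i and 0 elsewhere;
   representation matrices act on column vectors from the left. *)
Section ClassModule.
Variables (C : fieldType) (gT : finGroupType) (t : gT) (g : class_reps t).
Variables (d : nat) (rho : mx_representation C 'C[t]%g d).
Local Notation D := (drinfeld C gT).
Local Notation V := {ffun 'I_(creps_size g) -> 'cV[C]_d}.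
Local Notation conj_t i := (g i * t * (g i)^-1)%g.
Implicit Types (f h : D) (v : V).

Definition cm_p (h : gT) (v : V) : V :=
  [ffun i => if h == conj_t i then v i else 0].

(* x g_i = g_j gamma with gamma in 'C[t] means that
   gamma = g_j^-1 x g_i is in 'C[t]; given i, this holds for exactly
   one j. *)
Definition cm_x (x : gT) (v : V) : V :=
  [ffun j => \sum_(i | ((g j)^-1 * x * g i)%g \in 'C[t]%g)
      rho ((g j)^-1 * x * g i)%g *m v i].

Definition cm_fun (f : D) (v : V) : V :=
  \sum_(u : gT * gT) dcoef f u *: cm_p u.1 (cm_x u.2 v).

Lemma cm_p_linear k : linear (cm_p k).
Proof.
move=> c v w; apply/ffunP=> i; rewrite !ffunE.
by case: ifP; rewrite // scaler0 addr0.
Qed.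

Lemma cm_x_linear x : linear (cm_x x).
Proof.
move=> c v w; apply/ffunP=> j; rewrite !ffunE scaler_sumr -big_split.
by apply: eq_bigr => i _; rewrite !ffunE mulmxDr -scalemxAr.
Qed.

Lemma cm_fun_linear f : linear (cm_fun f).
Proof.
move=> c v w; rewrite /cm_fun scaler_sumr -big_split; apply: eq_bigr => u _ /=.
by rewrite cm_x_linear cm_p_linear scalerDr !scalerA mulrC.
Qed.

HB.instance Definition _ k := GRing.isLinear.Build C V V _
  (cm_p k) (cm_p_linear k).
HB.instance Definition _ x := GRing.isLinear.Build C V V _
  (cm_x x) (cm_x_linear x).
HB.instance Definition _ f :=
  GRing.isLinear.Build C V V _ (cm_fun f) (cm_fun_linear f).

Lemma cm_p_comp k l v : cm_p k (cm_p l v) = if k == l then cm_p k v else 0.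
Proof.
apply/ffunP=> i; rewrite !ffunE; case: (altP (k =P l)) => [<-|kl].
  by rewrite ffunE; case: (k == _).
rewrite ffunE; case: eqP => // ki; case: eqP => // li.
by rewrite ki li eqxx in kl.
Qed.

Lemma cent_conj (j i : 'I_(creps_size g)) x :
  (((g j)^-1 * x * g i)%g \in 'C[t]%g) = (x * conj_t i * x^-1 == conj_t j)%g.
Proof.
set y := (_ * g i)%g.
have -> : (x * conj_t i * x^-1 = g j * (y * t * y^-1) * (g j)^-1)%g.
  by rewrite /y !invMg !invgK !mulgA mulgV mul1g mulgK.
rewrite (inj_eq (mulIg _)) (inj_eq (mulgI _)).
apply/cent1P/eqP; rewrite /commute => E; first by rewrite E mulgK.
by rewrite -{2}E mulgKV.
Qed.

Lemma cm_x_p x k v : cm_x x (cm_p k v) = cm_p (x * k * x^-1)%g (cm_x x v).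
Proof.
apply/ffunP=> j; rewrite !ffunE; case: ifP => [/eqP kj|/eqP nkj].
  apply: eq_bigr => i; rewrite cent_conj => /eqP ij; rewrite ffunE.
  case: (altP (k =P _)) => // /eqP[]; move: ij; rewrite -kj.
  by move/mulIg/mulgI.
apply: big1 => i; rewrite cent_conj => /eqP ij; rewrite ffunE.
by case: (altP (k =P _)) => [ki|]; [case: nkj; rewrite ki|rewrite mulmx0].
Qed.

Lemma creps_surj x i : exists j, (x * conj_t i * x^-1 = conj_t j)%g.
Proof.
have: (x * conj_t i * x^-1)%g \in (t ^: [set: gT])%g.
  apply/imsetP; exists (x * g i)^-1%g; rewrite ?inE //.
  by rewrite conjgE invgK invMg !mulgA.
by rewrite -(creps_onto g) => /imsetP[j _ ->]; exists j.
Qed.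

Lemma cm_x1 v : cm_x 1 v = v.
Proof.
apply/ffunP=> j; rewrite ffunE (bigD1 j) /=; last first.
  by rewrite mulg1 mulVg group1.
rewrite mulg1 mulVg repr_mx1 mul1mx big1 ?addr0 // => i /andP[].
rewrite -{1}[(g j)^-1%g]mulg1 cent_conj invg1 mulg1 mul1g => /eqP E.
by case/negP; apply/eqP; apply: (creps_inj E).
Qed.

Lemma cm_xM x y v : cm_x (x * y)%g v = cm_x x (cm_x y v).
Proof.
apply/ffunP=> k; rewrite !ffunE.
transitivity (\sum_(j | ((g k)^-1 * x * g j)%g \in 'C[t]%g)
   \sum_(i | ((g j)^-1 * y * g i)%g \in 'C[t]%g)
     rho ((g k)^-1 * x * g j)%g *m (rho ((g j)^-1 * y * g i)%g *m v i));
  last by apply: eq_bigr => j _; rewrite ffunE mulmx_sumr.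
rewrite (exchange_big_dep
  (fun i => ((g k)^-1 * (x * y) * g i)%g \in 'C[t]%g)) /=.
  apply: eq_bigr => i; rewrite cent_conj => /eqP Eki.
  have [j Ej] := creps_surj y i.
  have Cj : ((g j)^-1 * y * g i)%g \in 'C[t]%g by rewrite cent_conj Ej.
  have Ck : ((g k)^-1 * x * g j)%g \in 'C[t]%g.
    by rewrite cent_conj -Ej -Eki invMg !mulgA.
  rewrite (bigD1 j) ?Cj ?Ck //= big1 ?addr0 => [|l].
    by rewrite mulmxA -repr_mxM // !mulgA mulgK.
  case/andP=> /andP[_]; rewrite cent_conj Ej => /eqP E /negP[].
  by apply/eqP/creps_inj; rewrite /= E.
move=> j i Cj Ci; have := groupM Cj Ci.
by rewrite !mulgA mulgK.
Qed.

Definition cm_act (f : D) : 'End(V) := linfun (cm_fun f).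

Lemma cm_act_linear : linear cm_act.
Proof.
move=> c f h; apply/lfunP=> v.
rewrite add_lfunE scale_lfunE !lfunE /= /cm_fun scaler_sumr -big_split.
by apply: eq_bigr => u _; rewrite dcoefD dcoefZ scalerDl scalerA.
Qed.

Lemma cm_fun_basis u v : cm_fun (dbasis C u) v = cm_p u.1 (cm_x u.2 v).
Proof.
rewrite /cm_fun (bigD1 u) //= dcoef_basis eqxx scale1r big1 ?addr0 // => w nw.
by rewrite dcoef_basis (negPf nw) scale0r.
Qed.

HB.instance Definition _ := GRing.isLinear.Build C D _ _ cm_act cm_act_linear.

Lemma cm_act1 : cm_act 1 = \1%VF.
Proof.
apply/lfunP=> v; rewrite id_lfunE linear_sum sum_lfunE.
under eq_bigr => k _ do rewrite lfunE /= cm_fun_basis /= cm_x1.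
apply/ffunP=> i; rewrite sum_ffunE (bigD1 (conj_t i)) //= ffunE eqxx.
by rewrite big1 ?addr0 // => k /negPf nk; rewrite ffunE nk.
Qed.

Lemma cm_actM f h : cm_act (f * h) = (cm_act f \o cm_act h)%VF.
Proof.
apply/lfunP=> v; rewrite comp_lfunE !lfunE /=.
have funE (k : D) w : cm_fun k w = cm_act k w by rewrite lfunE.
have -> : f * h =
  \sum_u \sum_w (dcoef f u * dcoef h w) *: dbasis_mul C u w by [].
rewrite [RHS]/cm_fun funE linear_sum sum_lfunE; apply: eq_bigr => u _.
rewrite linear_sum sum_lfunE /cm_fun linear_sum linear_sum scaler_sumr.
apply: eq_bigr => w _.
rewrite !linearZ /= !scale_lfunE scalerA mulrC; congr (_ *: _).
rewrite lfunE /= cm_x_p cm_p_comp /dbasis_mul.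
case: ifP => _; first by rewrite cm_fun_basis /= cm_xM.
by rewrite /cm_fun big1 // => z _; rewrite dcoef0 scale0r.
Qed.

Definition class_module : dmodule C gT := DModule cm_act_linear cm_act1 cm_actM.

End ClassModule.

(* Main.v *)
Require Import Defs.
From HB Require Import structures.
From mathcomp Require Import all_boot all_order all_fingroup all_algebra.
From mathcomp Require Import cyclic center mxrepresentation.
From mathcomp Require Import complex.
From mathcomp Require Import reals.
From mathcomp Require Import zify.

(* Since Lambda is supported on the p_1 |><| x, expanding the Sweedler power
   gives Lambda^[m] = |G|^-1 sum of p_u |><| x^m over the pairs (u, x) with
   (u x^-1)^m x^m = 1. Taking the trace on M(class(t), rho) and conjugating
   every class representative back to t yields
     nu_m = |C(t)|^-1 sum of tr rho(x^m) over the x with (t x^-1)^m x^m = 1.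
   For G = Q_4n and t = a^i, the x = a^k satisfy the condition iff t^m = 1, and
   contribute the average of the characters mu^(mjk), k < 2n, which is 1 or 0.
   The x = a^k b and x t^-1 both have square a^n, hence satisfy it iff m is
   even, and then contribute mu^(nmj/2) = (-1)^(mj/2). *)

Set Implicit Arguments.
Unset Strict Implicit.
Unset Printing Implicit Defensive.

Import GRing.Theory.

Local Open Scope ring_scope.

(** * Sums over pairs and tuples *)

Lemma big_pair (A : Type) (idx : A) (op : Monoid.com_law idx) (I J : finType)
    (F : I * J -> A) :
  \big[op/idx]_p F p = \big[op/idx]_i \big[op/idx]_j F (i, j).
Proof. by rewrite pair_bigA; apply: eq_bigr => [[]]. Qed.

Lemma big_tuple_cons (A : Type) (idx : A) (op : Monoid.com_law idx)
    (T : finType) m (F : m.+1.-tuple T -> A) :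
  \big[op/idx]_(s : m.+1.-tuple T) F s =
  \big[op/idx]_(u : T) \big[op/idx]_(s : m.-tuple T) F [tuple of u :: s].
Proof.
rewrite pair_bigA /=.
rewrite (reindex (fun p : T * m.-tuple T => [tuple of p.1 :: p.2])) //=.
exists (fun s => (thead s, [tuple of behead s])) => [[u s] _|s _] /=.
  by congr (_, _); apply: val_inj.
by rewrite [RHS]tuple_eta; apply: val_inj.
Qed.

(** * Sweedler powers in the Drinfel'd double *)

Section SweedlerPower.
Variables (C : fieldType) (gT : finGroupType).
Local Notation D := (drinfeld C gT).
Local Notation B := (gT * gT)%type.

(** Both legs of every term in the coproduct of p_g |><| x carry the same x, and g is the product of
    their group labels; hence at most one coefficient of [f] contributes. *)
Lemma dcomulE (f : D) (u v : B) :
  dcomul f (u, v) =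
    if u.2 == v.2 then dcoef f (u.1 * v.1, u.2)%g else 0.
Proof.
have delta_sum (w : B) : (\sum_(p : B | (p.1 * p.2 == w.1)%g)
      fdelta C ((p.1, w.2), (p.2, w.2))) (u, v) =
    [&& u.1 * v.1 == w.1, u.2 == w.2 & v.2 == w.2]%g%:R :> C.
  etransitivity; first exact: sum_ffunE.
  under eq_bigr => p _ do rewrite ffunE.
  case: eqP => [Ew|nEw] /=; last first.
    apply: big1 => p /eqP Ep; case: eqP => // Euv; case: nEw.
    by rewrite -Ep; case: Euv => -> ->.
  rewrite (bigD1 (u.1, v.1)) ?Ew ?eqxx //= big1 ?addr0 => [|p /andP[_ np]].
    by case: (u) (v) => [? ?] [? ?]; rewrite !xpair_eqE /= !eqxx.
  case: eqP => // Euv; case/negP: np; apply/eqP.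
  by case: Euv => -> ->; case: (p).
have -> : dcomul f (u, v) =
    \sum_w dcoef f w * [&& u.1 * v.1 == w.1, u.2 == w.2 & v.2 == w.2]%g%:R.
  etransitivity; first exact: sum_ffunE.
  by apply: eq_bigr => w _; rewrite ffunE delta_sum.
rewrite (bigD1 (u.1 * v.1, u.2)%g) //= !eqxx eq_sym big1 ?addr0 => [|w nw].
  by case: eqP; rewrite ?mulr1 ?mulr0.
case: and3P => [[/eqP E1 /eqP E2 _]|]; last by rewrite mulr0.
by rewrite E1 E2 -surjective_pairing eqxx in nw.
Qed.

Lemma sweedler_power0 (f : D) : sweedler_power 0 f = dcounit f *: 1.
Proof.
rewrite /sweedler_power /tensor_mul (bigD1 [tuple]) //=.
rewrite [X in _ + X]big1 ?addr0 => [|s].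
  by rewrite ffunE big_nil.
by rewrite [s]tuple0 => /eqP.
Qed.

Lemma sweedler_powerS m (f : D) :
  sweedler_power m.+1 f = \sum_(u : B) dbasis C u *
    sweedler_power m ([ffun v => dcomul f (u, v)] : {ffun B -> C^o}).
Proof.
rewrite /sweedler_power /tensor_mul big_tuple_cons; apply: eq_bigr => u _.
rewrite mulr_sumr; apply: eq_bigr => s _.
rewrite big_cons ffunE theadE -scalerAr; congr (_ *: _).
by congr (iter_comul _ _ _); apply: val_inj.
Qed.

(** All m tensor factors share one x, and the product of the p_(g_k) |><| x vanishes unless each
    g_(k+1) is x^-1 g_k x. So u = g_1 determines the others, and g_1 ... g_m telescopes to (u
    x^-1)^m x^m. *)
Lemma sweedler_powerE m (f : D) :
  sweedler_power m f =
  \sum_(x : gT) \sum_(u : gT)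
    dcoef f ((u * x^-1) ^+ m * x ^+ m, x)%g *: dbasis C (u, x ^+ m)%g.
Proof.
elim: m f => [|m IHm] f.
  rewrite sweedler_power0 /dcounit scaler_suml.
  rewrite big_pair exchange_big; apply: eq_bigr => x _ /=.
  rewrite (bigD1 1%g) //= big1 ?addr0 => [|g /negPf->]; last first.
    by rewrite mulr0 scale0r.
  under [RHS]eq_bigr => u _ do rewrite !expg0 mul1g.
  by rewrite eqxx mulr1 -scaler_sumr.
rewrite sweedler_powerS.
under eq_bigr => u _ do rewrite IHm mulr_sumr.
rewrite exchange_big; apply: eq_bigr => x _ /=.
rewrite big_pair; apply: eq_bigr => u _.
rewrite (bigD1 x) //= [X in _ + X]big1 ?addr0 => [|y /negPf nyx].
  (* Multiplication by p_u |><| x on the left kills every p_g |><| x^m except the one with u = x g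
     x^-1. *)
  rewrite mulr_sumr (bigD1 (x^-1 * u * x)%g) //= [X in _ + X]big1 ?addr0.
    rewrite -scalerAr [_ * _]dmul_basis /dbasis_mul /=.
    rewrite !mulgA mulgV mul1g !mulgK eqxx -expgS; congr (_ *: _).
    rewrite /dcoef ffunE dcomulE eqxx /=; congr (dcoef f (_, x)).
    rewrite [in RHS]expgSr [in RHS]expgS -!mulgA mulKg !mulgA.
    (* After cancelling x^m it remains that u (x^-1 u)^m = (u x^-1)^m u. *)
    congr (_ * _)%g; elim: m {IHm} => [|m IHm]; first by rewrite mulg1 mul1g.
    by rewrite expgSr (expgSr (x^-1 * u))%g mulgA IHm !mulgA.
  move=> g ng; rewrite -scalerAr [_ * _]dmul_basis /dbasis_mul /=.
  case: (altP (u =P _)) ng => [->|]; last by rewrite scaler0.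
  by rewrite !mulgA mulVg mul1g mulgKV eqxx.
rewrite big1 ?mulr0 // => g _.
by rewrite /dcoef ffunE dcomulE /= nyx scale0r.
Qed.

End SweedlerPower.

(** * Traces, characters and the integral *)

(** Each map sending v to phi_k(v) w_k has rank at most one and trace phi_k(w_k). This allows traces
    to be computed in an explicit family instead of the abstract [vbasis]. *)
Lemma trace_mxof (C : fieldType) (vT : vectType C) (h : 'End(vT))
    (K : finType) (phi : K -> {linear vT -> C^o}) (w : K -> vT) :
  (forall v, h v = \sum_k phi k v *: w k) ->
  \tr (passmx.mxof (vbasis {:vT}) (vbasis {:vT}) h) = \sum_k phi k (w k).
Proof.
set e := vbasis _ => hE; have eP : basis_of {:vT} e by apply: vbasisP.
rewrite /mxtrace.
transitivity (\sum_(i < \dim {:vT}) \sum_k phi k e`_i * coord e i (w k) : C).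
  apply: eq_bigr => i _.
  rewrite /passmx.mxof mxE /= mxE passmx.vecof_delta hE linear_sum.
  by apply: eq_bigr => k _; rewrite linearZ.
rewrite exchange_big; apply: eq_bigr => k _ /=.
rewrite [in RHS](coord_basis eP (memvf (w k))) linear_sum.
by apply: eq_bigr => i _; rewrite linearZ mulrC.
Qed.

Lemma dcharacter_linear (C : fieldType) (gT : finGroupType)
    (V : dmodule C gT) : linear (dcharacter V : drinfeld C gT -> C^o).
Proof.
move=> c f h; rewrite /dcharacter dmod_linear passmx.mxof_linear.
by rewrite linearD linearZ.
Qed.

Lemma dcharacterZ (C : fieldType) (gT : finGroupType) (V : dmodule C gT) c f :
  dcharacter V (c *: f) = c * dcharacter V f.
Proof.
have lin := dcharacter_linear V.
have chi0 : dcharacter V 0 = 0.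
  have := lin 1 0 0; rewrite !scale1r addr0 => /eqP.
  by rewrite -subr_eq subrr => /eqP.
by have := lin c f 0; rewrite chi0 !addr0.
Qed.

Lemma dcharacter_sum (C : fieldType) (gT : finGroupType) (V : dmodule C gT)
    (J : finType) (F : J -> drinfeld C gT) :
  dcharacter V (\sum_j F j) = \sum_j dcharacter V (F j).
Proof.
apply: (big_morph (dcharacter V)) => [f h|].
  by have := dcharacter_linear V 1 f h; rewrite !scale1r.
by have := dcharacterZ V 0 0; rewrite scale0r mul0r.
Qed.

Lemma dcoef_dintegral (C : fieldType) (gT : finGroupType) (u : gT * gT) :
  dcoef (dintegral C gT) u = #|gT|%:R^-1 * (u.1 == 1%g)%:R.
Proof.
rewrite /dintegral dcoefZ; congr (_ * _).
rewrite (big_morph (@dcoef C gT ^~ u)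
  (fun f h => dcoefD f h _) (@dcoef0 C gT u)).
rewrite (bigD1 u.2) //= big1 ?addr0 => [|x /negPf nx].
  by rewrite dcoef_basis {1}[u]surjective_pairing xpair_eqE eqxx andbT.
by rewrite dcoef_basis {1}[u]surjective_pairing xpair_eqE andbC eq_sym nx.
Qed.

Lemma creps_size_index (gT : finGroupType) (t : gT) (g : class_reps t) :
  (creps_size g * #|'C[t]%g| = #|gT|)%N.
Proof.
have <-: #|(t ^: [set: gT])%g| = creps_size g.
  by rewrite -(creps_onto g) card_imset ?card_ord //; apply: creps_inj.
by rewrite -index_cent1 setTI -cardsT mulnC Lagrange ?subsetT.
Qed.

(** * Character and indicators of M(class(t), rho) *)

Section ClassModuleIndicator.
Variables (C : fieldType) (gT : finGroupType) (t : gT) (g : class_reps t).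
Variables (d : nat) (rho : mx_representation C 'C[t]%g d).
Local Notation D := (drinfeld C gT).
Local Notation N := (creps_size g).
Local Notation V := {ffun 'I_N -> 'cV[C]_d}.

Definition cm_coord (p : 'I_N * 'I_d) (v : V) : C^o := v p.1 p.2 0.

Lemma cm_coord_linear p : linear (cm_coord p).
Proof. by move=> c v w; rewrite /cm_coord !ffunE !mxE. Qed.

HB.instance Definition _ p := GRing.isLinear.Build C V C^o _
  (cm_coord p) (cm_coord_linear p).

(** The block g_i (x) W meets the diagonal only if x maps it to itself, that is, g_i^-1 x g_i
    centralises t, and p_u keeps it only if u = t_i. The diagonal block is then rho(g_i^-1 x
    g_i). *)
Lemma dcharacter_class_module_basis (u x : gT) :
  dcharacter (class_module g rho) (dbasis C (u, x)) =
  \sum_i if (u == g i * t * (g i)^-1)%g && ((g i)^-1 * x * g i \in 'C[t])%g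
         then \tr (rho ((g i)^-1 * x * g i)%g) else 0.
Proof.
pose e (p : 'I_N * 'I_d) : V :=
  [ffun i => if i == p.1 then delta_mx p.2 0 else 0].
pose T := cm_act g rho (dbasis C (u, x)) : 'End(V).
(* Expanding T v in the basis [e] gives the coefficients phi_p(v), so phi_p(e_p) is a diagonal entry
   of T. *)
pose phi p : {linear V -> C^o} := (cm_coord p \o T : {linear V -> C^o}).
have V_sum (v : V) : v = \sum_p cm_coord p v *: e p.
  apply/ffunP => i; rewrite sum_ffunE big_pair (bigD1 i) //=.
  rewrite [X in _ + X]big1 ?addr0 => [|k nk].
    rewrite [v i]matrix_sum_delta; apply: eq_bigr => k _.
    by rewrite big_ord1 !ffunE eqxx.
  by rewrite big1 // => l _; rewrite !ffunE eq_sym (negPf nk) scaler0.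
rewrite /dcharacter (trace_mxof (phi := phi) (w := e)); last first.
  by move=> v; apply: V_sum.
rewrite big_pair; apply: eq_bigr => i _.
have phiE k : phi (i, k) (e (i, k)) =
    if (u == g i * t * (g i)^-1)%g && ((g i)^-1 * x * g i \in 'C[t])%g
    then rho ((g i)^-1 * x * g i)%g k k else 0.
  rewrite /phi /= /cm_coord /T lfunE /= cm_fun_basis ffunE /=.
  case: (u == _) => /=; last by rewrite mxE.
  rewrite ffunE.
  under eq_bigr => l _ do rewrite ffunE (fun_if (mulmx _)) mulmx0.
  rewrite -big_mkcondr /= big_mkcond (bigD1 i) //= big1 ?addr0 => [|l /negPf->].
    rewrite eqxx andbT; case: ifP => _; last by rewrite mxE.
    by rewrite -colE mxE.
  by rewrite andbF.
under eq_bigr => k _ do rewrite phiE.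
by case: ifP => _ //; rewrite big1.
Qed.

Lemma indicator_class_module m : #|gT|%:R != 0 :> C ->
  indicator m (class_module g rho) = #|'C[t]%g|%:R^-1 *
    \sum_(x : gT | ((t * x^-1) ^+ m * x ^+ m == 1)%g) \tr (rho (x ^+ m)%g).
Proof.
move=> oG0; have oG : #|gT|%:R = N%:R * #|'C[t]%g|%:R :> C.
  by rewrite -natrM creps_size_index.
have N0 : N%:R != 0 :> C by move: oG0; rewrite oG mulf_eq0 => /norP[].
set S := \sum_(x | _) _.
(* Each of the N representatives contributes the same sum S, and N / |G| = 1 / |C(t)|. *)
suff E (i : 'I_N) :
    \sum_x \sum_u (u == g i * t * (g i)^-1)%g%:R *
      (((u * x^-1) ^+ m * x ^+ m == 1)%g%:R *
       if ((g i)^-1 * x ^+ m * g i \in 'C[t])%g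
         then \tr (rho ((g i)^-1 * x ^+ m * g i)%g) else 0) = S.
  rewrite /indicator sweedler_powerE dcharacter_sum /=.
  transitivity (\sum_(i < N) #|gT|%:R^-1 * S); last first.
    by rewrite sumr_const card_ord -[LHS]mulr_natl oG invfM -mulrA mulVKf.
  under [RHS]eq_bigr => i _ do rewrite -(E i) mulr_sumr.
  rewrite [RHS]exchange_big; apply: eq_bigr => x _ /=.
  under [RHS]eq_bigr => i _ do rewrite mulr_sumr.
  rewrite [RHS]exchange_big dcharacter_sum; apply: eq_bigr => u _ /=.
  rewrite dcharacterZ dcharacter_class_module_basis /= dcoef_dintegral /=.
  rewrite [LHS]mulr_sumr; apply: eq_bigr => i _.
  rewrite -mulrA; congr (_ * _); rewrite -mulrCA; congr (_ * _).
  by case: (u == _); rewrite ?mul1r ?mul0r.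
transitivity (\sum_x
    ((((g i * t * (g i)^-1) * x^-1) ^+ m * x ^+ m == 1)%g%:R *
       if ((g i)^-1 * x ^+ m * g i \in 'C[t])%g
         then \tr (rho ((g i)^-1 * x ^+ m * g i)%g) else 0)).
  apply: eq_bigr => x _; rewrite (bigD1 (g i * t * (g i)^-1)%g) //= eqxx mul1r.
  by rewrite [X in _ + X]big1 ?addr0 // => u /negPf->; rewrite mul0r.
(* Substituting g_i x g_i^-1 for x turns the condition for t_i into the one for t. *)
rewrite (reindex_inj (conjg_inj (g i)^-1)%g) /= /S [RHS]big_mkcond.
apply: eq_bigr => x _.
have -> : (g i * t * (g i)^-1 * (x ^ (g i)^-1)^-1 = (t * x^-1) ^ (g i)^-1)%g.
  by rewrite conjMg conjVg !conjgE !invgK !mulgA.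
rewrite -!conjXg -conjMg conjg_eq1.
have -> : ((g i)^-1 * (x ^+ m) ^ (g i)^-1 * g i = x ^+ m)%g.
  by rewrite -mulgA -conjgE conjgKV.
case: eqP => [E|_]; last by rewrite mul0r.
(* The condition makes x^m the inverse of a power of t x^-1, so x^m commutes with t x^-1 and with x,
   hence with t. *)
rewrite mul1r; suff -> : (x ^+ m)%g \in 'C[t]%g by [].
apply/cent1P.
have cx : commute (x ^+ m)%g x by apply/commute_sym/commuteX.
have ctx : commute (x ^+ m)%g (t * x^-1)%g.
  have -> : (x ^+ m = ((t * x^-1) ^+ m)^-1)%g.
    by apply/eqP; rewrite eq_sym eq_invg_mul E.
  by apply/commute_sym/commuteV/commuteX.
by have := commuteM ctx cx; rewrite mulgKV.
Qed.

End ClassModuleIndicator.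

(** * A permutation model of the generalized quaternion group *)

(* Left multiplication by a and b on the words a^k b^e, the pair (k, e) standing
   for a^k b^e. Products of permutations act from left to right, but the
   relations of Q_4n also hold in its opposite group. *)
Section QuaternionModel.
Variable n : nat.
Hypothesis n_gt0 : (0 < n)%N.
Local Notation T := ('Z_(2 * n) * bool)%type.

Definition quaternion_a_fun (p : T) : T := (p.1 + 1, p.2).
(** These are b a^k = a^-k b and b a^k b = a^-k b^2 = a^(n-k). *)
Definition quaternion_b_fun (p : T) : T :=
  if p.2 then (n%:R - p.1, false) else (- p.1, true).

Lemma quaternion_a_inj : injective quaternion_a_fun.
Proof.
move=> [k e] [l f] E; have /addIr /= -> := congr1 fst E.
by have /= -> := congr1 snd E.
Qed.

Lemma quaternion_b_inj : injective quaternion_b_fun.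
Proof.
move=> [k []] [l []] E //; have /= := congr1 fst E.
  by move/addrI/oppr_inj->.
by move/oppr_inj->.
Qed.

Definition quaternion_a := perm quaternion_a_inj.
Definition quaternion_b := perm quaternion_b_inj.

Lemma quaternion_aX k p : (quaternion_a ^+ k)%g p = (p.1 + k%:R, p.2).
Proof.
elim: k => [|k IHk]; first by rewrite perm1 addr0 -surjective_pairing.
by rewrite expgSr permM IHk permE /quaternion_a_fun /= -addrA -natr1.
Qed.

Lemma quaternion_model_relations :
  [/\ quaternion_a ^+ (2 * n) = 1, quaternion_b ^+ 2 = quaternion_a ^+ n
    & quaternion_b * quaternion_a * quaternion_b^-1 = quaternion_a^-1]%g.
Proof.
have gt1 : (1 < 2 * n)%N by rewrite mul2n -addnn -(addn1 1) leq_add.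
have n2 : (2 * n)%:R = 0 :> 'Z_(2 * n) by rewrite pchar_Zp.
split.
- by apply/permP=> -[k e]; rewrite quaternion_aX perm1 n2 addr0.
- apply/permP=> -[k e]; rewrite expgS expg1 permM !permE quaternion_aX.
  rewrite /quaternion_b_fun; case: e => /=; last by rewrite opprK addrC.
  rewrite opprB; congr (_ + _, _); apply/esym/eqP.
  by rewrite -addr_eq0 -natrD addnn -mul2n n2.
(* The relation is brought to the inverse-free form a b a = b. *)
apply/eqP; rewrite eq_sym eq_invg_mul mulgA -eq_mulgV1 mulgA.
apply/eqP/permP=> -[k e].
rewrite !permM !permE /quaternion_b_fun /quaternion_a_fun; case: e => /=.
  by rewrite opprD addrA addrNK.
by rewrite opprD addrNK.
Qed.

(** The orbit of the empty word consists of all 4n words. *)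
Lemma card_quaternion_model :
  (4 * n <= #|<[quaternion_a]> <*> <[quaternion_b]>|%g)%N.
Proof.
have gt1 : (1 < 2 * n)%N by rewrite mul2n -addnn -(addn1 1) leq_add.
pose H := (<[quaternion_a]> <*> <[quaternion_b]>)%G.
have aH : quaternion_a \in H by rewrite mem_gen // inE cycle_id.
have bH : quaternion_b \in H by rewrite mem_gen // inE cycle_id orbT.
have <- : #|{: T}| = (4 * n)%N.
  by rewrite card_prod card_bool card_ord Zp_cast // mulnC mulnA.
apply: leq_trans (leq_imset_card (fun s : {perm T} => s (0, false)) H).
apply/subset_leq_card/subsetP=> -[k []] _; apply/imsetP.
  (* The left factor acts first: it leads to (-k, false), and then b negates the exponent. *)
  exists (quaternion_a ^+ (- k)%R * quaternion_b)%g.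
    by rewrite groupM ?groupX.
  by rewrite permM quaternion_aX natr_Zp permE /quaternion_b_fun /= add0r opprK.
exists (quaternion_a ^+ k)%g; first by rewrite groupX.
by rewrite quaternion_aX /= add0r natr_Zp.
Qed.

End QuaternionModel.

(** * Normal forms and centralisers in the generalized quaternion group *)

Section GeneralizedQuaternion.
Variables (n : nat) (gT : finGroupType) (a b : gT).
Hypotheses (n_gt0 : (0 < n)%N) (Gab : generalized_quaternion n a b).

(** The model satisfies the defining relations, so by the universal property of [Grp] it is a
    homomorphic image of the group. *)
Lemma card_generalized_quaternion_ge : (4 * n <= #|gT|)%N.
Proof.
case: Gab => isoG _ _ _ _.
have [a2n b2 bab] := quaternion_model_relations n_gt0.
apply: leq_trans (card_quaternion_model n_gt0) _; rewrite -cardsT.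
apply: leq_homg; rewrite isoG; apply/existsP.
exists (quaternion_a n, quaternion_b n).
by rewrite /= !xpair_eqE a2n b2 bab !eqxx.
Qed.

Lemma quaternion_conj k : (b * a ^+ k = a ^- k * b)%g.
Proof.
case: Gab => _ _ _ _ bab.
have -> : (a ^- k = (b * a * b^-1) ^+ k)%g by rewrite bab expgVn.
elim: k => [|k IHk]; first by rewrite mulg1 mul1g.
by rewrite (expgSr a) (expgSr (_ * _)) [LHS]mulgA IHk !mulgA mulgKV.
Qed.

Definition quaternion_elt (p : 'I_(2 * n) * bool) : gT :=
  (a ^+ p.1 * b ^+ p.2)%g.

Lemma quaternion_elt_onto x : exists p, quaternion_elt p = x.
Proof.
case: Gab => _ genG a2n b2 bab.
have gt0 : (0 < 2 * n)%N by rewrite muln_gt0.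
have: x \in <<[set a; b]>>%g by rewrite genG inE.
have -> : <<[set a; b]>>%g = (<[a]> <*> <[b]>)%g.
  by rewrite joing_idl joing_idr.
rewrite norm_joinEr; last first.
  (* That b normalises <a> is shown for b^-1, because conjugation by b^-1 is the map a to b a b^-1
     of the relation. *)
  rewrite cycle_subG -groupV inE -cycleJ cycle_subG.
  by rewrite conjgE invgK mulgA bab groupV cycle_id.
case/mulsgP=> _ _ /cycleP[k ->] /cycleP[l ->] ->.
have -> : (b ^+ l = a ^+ (n * l./2) * b ^+ odd l)%g.
  by rewrite -{1}(odd_double_half l) addnC expgD -mul2n !expgM b2.
exists (Ordinal (ltn_pmod (k + n * l./2) gt0), odd l).
by rewrite /quaternion_elt /= expg_mod // expgD mulgA.
Qed.

(** A surjection from 4n words onto a group of at least 4n elements is a bijection. *)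
Lemma quaternion_elt_bij : bijective quaternion_elt.
Proof.
have ex x : {p | quaternion_elt p == x}.
  apply: sigW; have [p <-] := quaternion_elt_onto x; by exists p.
pose g x := sval (ex x).
have gK : cancel g quaternion_elt by move=> x; apply/eqP/(svalP (ex x)).
have [|f gf fg] := inj_card_bij (can_inj gK).
  rewrite card_prod card_ord card_bool mulnC mulnA.
  exact: card_generalized_quaternion_ge.
by exists g => // p; rewrite -{1}(fg p) gK fg.
Qed.

Lemma card_generalized_quaternion : #|gT| = (4 * n)%N.
Proof.
rewrite -(bij_eq_card quaternion_elt_bij) card_prod card_ord card_bool.
by rewrite mulnC mulnA.
Qed.

(** A smaller order r would give the distinct normal forms a^r and a^0 of the identity. *)
Lemma order_quaternion_a : #[a]%g = (2 * n)%N.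
Proof.
case: Gab => _ _ a2n _ _.
have gt0 : (0 < 2 * n)%N by rewrite muln_gt0.
have dv : (#[a]%g %| 2 * n)%N by rewrite order_dvdn a2n.
apply/eqP; rewrite eqn_leq dvdn_leq //= leqNgt; apply/negP=> lt.
have := bij_inj quaternion_elt_bij
  (x1 := (Ordinal lt, false)) (x2 := (Ordinal gt0, false)).
rewrite /quaternion_elt /= expg_order => /(_ erefl) [] /eqP.
by rewrite eqn0Ngt order_gt0.
Qed.

Lemma quaternion_sqr k : ((a ^+ k * b) ^+ 2 = a ^+ n)%g.
Proof.
case: Gab => _ _ _ b2 _.
by rewrite expgS expg1 mulgA -(mulgA _ b) quaternion_conj mulgA mulgV mul1g -b2.
Qed.

(** If some a^l b centralised a^k, so would b; as a does too, a^k would be central. *)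
Lemma cent1_quaternion k :
  (a ^+ k)%g \notin 'Z([set: gT])%g -> 'C[(a ^+ k)%g]%g = <[a]>%g.
Proof.
move=> nZ; case: Gab => _ genG _ _ _.
have aC : a \in 'C[(a ^+ k)%g]%g by apply/cent1P/commuteX.
apply/eqP; rewrite eqEsubset cycle_subG aC andbT; apply/subsetP=> x xC.
have [[l []] Ex] := quaternion_elt_onto x; last first.
  by rewrite -Ex /quaternion_elt mulg1 mem_cycle.
case/negP: nZ; apply/centerP; split=> [|y _]; first by rewrite inE.
have bC : b \in 'C[(a ^+ k)%g]%g.
  by move: xC; rewrite -Ex /quaternion_elt /= expg1 groupMl // groupX.
apply/cent1P; rewrite -cent1C.
suff: y \in 'C[(a ^+ k)%g]%g by [].
have: y \in <<[set a; b]>>%g by rewrite genG inE.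
by apply/subsetP; rewrite gen_subG; apply/subsetP=> z /set2P[] ->.
Qed.

End GeneralizedQuaternion.

(** * Roots of unity and reduction of integer exponents *)

Lemma sum_expr_unity (C : fieldType) (N : nat) (w : C) :
  w ^+ N = 1 -> \sum_(k < N) w ^+ k = if w == 1 then N%:R else 0.
Proof.
move=> wN; case: eqP => [->|/eqP w1].
  by under eq_bigr do rewrite expr1n; rewrite sumr_const card_ord.
apply/(mulfI (x := w - 1)); first by rewrite subr_eq0.
by rewrite mulr0 -subrX1 wN subrr.
Qed.

Lemma prim_expr_half (C : fieldType) (n : nat) (mu : C) :
  (2 * n)%N.-primitive_root mu -> mu ^+ n = -1.
Proof.
move=> mu_prim; have := prim_order_gt0 mu_prim; rewrite muln_gt0 /= => n_gt0.
have : (mu ^+ n) ^+ 2 == 1 by rewrite -exprM mulnC prim_expr_order.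
rewrite sqrf_eq1 => /orP[|/eqP//]; rewrite -(prim_order_dvd mu_prim).
by move/dvdn_leq; rewrite n_gt0 => /(_ erefl); lia.
Qed.

Lemma expgz_mod (gT : finGroupType) (x : gT) (N : nat) (i : int) :
  (0 < N)%N -> (x ^+ N = 1)%g -> expgz x i = (x ^+ `|(i %% N)%Z|)%g.
Proof.
move=> N_gt0 xN; have E := divz_eq i N.
have r_ge0 : 0 <= (i %% N)%Z by rewrite modz_ge0 //; lia.
case: i E r_ge0 => k /= E r_ge0.
  by rewrite modz_nat absz_nat expg_mod.
apply/eqP; rewrite eq_invg_mul -expgD.
(* Here i = -(k+1), so the claim is that N divides k+1 plus the remainder of i. *)
suff /dvdnP[q ->] : (N %| k.+1 + `|(Negz k %% N)%Z|)%N.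
  by rewrite mulnC expgM xN expg1n.
change (N%:Z %| (k.+1 + `|(Negz k %% N)%Z|)%N%:Z)%Z.
apply/dvdzP; exists (- (Negz k %/ N)%Z).
by rewrite PoszD gez0_abs // mulNr; lia.
Qed.

Lemma expz_mod (C : fieldType) (N : nat) (z : C) (i : int) :
  N.-primitive_root z -> z ^ i = z ^+ `|(i %% N)%Z|.
Proof.
move=> z_prim; have N_gt0 := prim_order_gt0 z_prim.
have z0 : z != 0.
  apply/eqP=> z0; have := prim_expr_order z_prim.
  by move/eqP; rewrite z0 expr0n eqn0Ngt N_gt0 eq_sym oner_eq0.
have r_ge0 : 0 <= (i %% N)%Z by rewrite modz_ge0 //; lia.
rewrite {1}(divz_eq i N) expfzDr // (mulrC _ N%:Z) -exprz_exp -exprnP.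
by rewrite (prim_expr_order z_prim) exp1rz mul1r -{1}(gez0_abs r_ge0).
Qed.

(** * The indicator for natural exponents *)

Section QuaternionIndicator.
Variables (C : fieldType) (n : nat) (gT : finGroupType) (a b : gT).
Hypotheses (n_gt0 : (0 < n)%N) (Gab : generalized_quaternion n a b).
Hypothesis oG0 : #|gT|%:R != 0 :> C.

(** The summands come from the cosets <a> and <a>b. The element t is a variable with an equation
    because the type of [chi] depends on it, while [expgz a i] must be traded for a natural power of
    a. *)
Lemma indicator_quaternion (i j m : nat) (t : gT) (mu : C)
    (g : class_reps t) (chi : mx_representation C 'C[t]%g 1) :
  t = (a ^+ i)%g -> t \notin 'Z([set: gT])%g ->
  (2 * n)%N.-primitive_root mu -> chi a = (mu ^+ j)%:M ->
  indicator m (class_module g chi) =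
    [&& (2 * n %| m * i) & (2 * n %| m * j)]%N%:R +
    (if odd m then 0 else (-1) ^+ (m./2 * j)).
Proof.
move=> Et nZ mu_prim chia; have mun := prim_expr_half mu_prim.
have Ct : 'C[t]%g = <[a]>%g by rewrite Et (cent1_quaternion n_gt0 Gab) // -Et.
have oC : #|'C[t]%g| = (2 * n)%N.
  by rewrite Ct -orderE (order_quaternion_a n_gt0 Gab).
have dvd_a l : (2 * n %| l)%N = (a ^+ l == 1)%g.
  by rewrite -(order_quaternion_a n_gt0 Gab) order_dvdn.
have chiX k : \tr (chi (a ^+ k)%g) = mu ^+ (j * k).
  have -> : chi (a ^+ k)%g = (mu ^+ (j * k))%:M; last by rewrite mxtrace_scalar.
  have aC : a \in 'C[t]%g by rewrite Ct cycle_id.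
  elim: k => [|k IHk]; first by rewrite muln0 repr_mx1.
  by rewrite expgSr repr_mxM ?groupX // IHk chia -scalar_mxM mulnSr exprD.
have t_neq1 : t != 1%g by apply: contraNneq nZ => ->; apply: group1.
have taC k : commute t (a ^+ k)%g.
  by rewrite Et; apply/commuteX/commute_sym/commuteX.
have n2C : (2 * n)%:R != 0 :> C.
  by move: oG0; rewrite -(creps_size_index g) oC natrM mulf_eq0 => /norP[].
rewrite indicator_class_module // big_mkcond /=.
rewrite (reindex (quaternion_elt (n := n) a b)) /=; last first.
  exact: onW_bij (quaternion_elt_bij n_gt0 Gab).
rewrite big_pair.
under eq_bigr => k _ do rewrite big_bool /=.
(* [big_bool] lists the a^k b first; the powers of a are moved to the front. *)
rewrite big_split /= addrC mulrDr oC.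
congr (_ + _).
  have E (k : 'I_(2 * n)) : ((t * (quaternion_elt a b (k, false))^-1) ^+ m *
       quaternion_elt a b (k, false) ^+ m = t ^+ m)%g.
    rewrite /quaternion_elt /= mulg1 -expgMn; first by rewrite mulgKV.
    apply: commute_sym; apply: commuteM; first exact/commute_sym/taC.
    exact: commuteV.
  transitivity ((2 * n)%:R^-1 *
      \sum_(k < 2 * n) if (2 * n %| m * i)%N then (mu ^+ (m * j)) ^+ k else 0).
    congr (_ * _); apply: eq_bigr => k _; rewrite E.
    have -> : (t ^+ m = a ^+ (m * i))%g by rewrite Et mulnC expgM.
    rewrite dvd_a.
    case: ifP => // _; rewrite /quaternion_elt /= mulg1 -expgM chiX -exprM.
    by congr (_ ^+ _); lia.
  case: (2 * n %| m * i)%N => /=; last by rewrite big1 ?mulr0.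
  rewrite sum_expr_unity; last first.
    by rewrite exprAC (prim_expr_order mu_prim) expr1n.
  rewrite -(prim_order_dvd mu_prim).
  by case: ifP => _; rewrite ?mulr0 ?mulVf.
transitivity ((2 * n)%:R^-1 *
    \sum_(k < 2 * n) if odd m then 0 else (-1) ^+ (m./2 * j) : C); last first.
  rewrite sumr_const card_ord -[X in _ * X]mulr_natl mulrA mulVf ?mul1r //.
congr (_ * _); apply: eq_bigr => k _.
rewrite /quaternion_elt /= expg1; set x := (a ^+ k * b)%g.
have x2 : (x ^+ 2 = a ^+ n)%g by apply: (quaternion_sqr Gab).
(* The inverse of t x^-1 is x t^-1 = a^(k+i) b, whose square is a^n. *)
have tx2 : ((t * x^-1) ^+ 2 = a ^- n)%g.
  rewrite -[(t * _)%g]invgK invMg invgK expgVn; congr (_^-1)%g.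
  have -> : (x * t^-1 = a ^+ (k + i) * b)%g; last exact: (quaternion_sqr Gab).
  apply: (mulIg (a ^+ i)%g); rewrite /x Et mulgKV expgD -!mulgA.
  by rewrite (quaternion_conj Gab) mulVKg.
have xX l : (x ^+ (l * 2) = a ^+ (n * l))%g by rewrite mulnC !expgM x2.
have txX l : ((t * x^-1) ^+ (l * 2) = a ^- (n * l))%g.
  by rewrite mulnC expgM tx2 expgVn -expgM.
rewrite -{1 2 3}(odd_double_half m) -muln2; case: (odd m).
  rewrite expgSr expgS txX xX.
  (* For m = 2l+1 the product is a^(-nl) t a^(nl) = t, which differs from 1. *)
  rewrite ifF //; apply: contraNF t_neq1 => /eqP E.
  have -> : t = (a ^- (n * m./2) * (t * x^-1) * (x * a ^+ (n * m./2)))%g.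
    by rewrite -mulgA (mulgA (t * _)%g) mulgKV taC mulKg.
  by rewrite E.
rewrite !add0n txX xX mulVg eqxx chiX.
by rewrite -mun -exprM; congr (_ ^+ _); rewrite mulnCA (mulnC j) mulnA.
Qed.

End QuaternionIndicator.

(** * Integer parameters and the case distinction *)

(** Passing to the remainder of i modulo N changes m i by a multiple of m N, hence of d. *)
Lemma dvdz_mul_mod (d N m : nat) (i : int) :
  (0 < N)%N -> (d %| m * N)%N ->
  (d%:Z %| m%:Z * i)%Z = (d %| m * `|(i %% N)%Z|)%N.
Proof.
move=> N_gt0 /dvdnP[q dmN].
have r_ge0 : 0 <= (i %% N)%Z by rewrite modz_ge0 //; lia.
rewrite {1}(divz_eq i N) mulrDr mulrCA -PoszM dmN PoszM -{1}(gez0_abs r_ge0).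
by rewrite rpredDl // mulrA dvdz_mull.
Qed.

Theorem theorem7p4 (R : realType) (n : nat) (gT : finGroupType) (a b : gT)
    (i j : int) (mu : R[i]) (g : class_reps (expgz a i))
    (chi : mx_representation R[i] 'C[expgz a i]%g 1) (m : nat) :
  (2 <= n)%N ->
  generalized_quaternion n a b ->
  expgz a i \notin 'Z([set: gT])%g ->
  (2 * n)%N.-primitive_root mu ->
  chi a = (mu ^ j)%:M ->
  (1 <= m)%N ->
  let V := class_module g chi in
  let two_m := (2 %| m)%N in
  let four_mj := (4 %| m%:Z * j)%Z in
  let n_mi := ((2 * n)%N%:Z %| m%:Z * i)%Z in
  let n_mj := ((2 * n)%N%:Z %| m%:Z * j)%Z in
  [/\ [&& two_m, four_mj, n_mi & n_mj] -> indicator m V = 2,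
      [&& ~~ two_m, n_mi & n_mj]
        || [&& two_m, four_mj & (~~ n_mi || ~~ n_mj)] -> indicator m V = 1,
      [&& ~~ two_m & (~~ n_mi || ~~ n_mj)]
        || [&& two_m, ~~ four_mj, n_mi & n_mj] -> indicator m V = 0
    & [&& two_m, ~~ four_mj & (~~ n_mi || ~~ n_mj)] -> indicator m V = -1].
Proof.
move=> n_gt1 Gab nZ mu_prim chia _ V two_m four_mj n_mi n_mj.
have n_gt0 : (0 < n)%N by apply: leq_trans n_gt1.
have N_gt0 : (0 < 2 * n)%N by rewrite muln_gt0.
have oG0 : #|gT|%:R != 0 :> R[i].
  rewrite (card_generalized_quaternion n_gt0 Gab) Num.Theory.pnatr_eq0.
  by rewrite muln_eq0 -lt0n.
have [_ _ a2n _ _] := Gab.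
have ai : expgz a i = (a ^+ `|(i %% (2 * n)%N)%Z|)%g by apply: expgz_mod.
rewrite (expz_mod j mu_prim) in chia.
have -> : indicator m V = (n_mi && n_mj)%:R +
    (if two_m then if four_mj then 1 else -1 else 0).
  rewrite (indicator_quaternion n_gt0 Gab oG0 m g ai nZ mu_prim chia).
  have dN : (2 * n %| m * (2 * n))%N by apply: dvdn_mull.
  rewrite /n_mi /n_mj !(dvdz_mul_mod _ N_gt0 dN).
  congr (_ + _); rewrite /two_m dvdn2; case: ifP => //= /negbT m_even.
  have m2 : m = (m./2 * 2)%N by rewrite muln2 even_halfK.
  (* Since m is even, 4 divides 2nm, so j may be reduced modulo 2n here as well. *)
  rewrite /four_mj (@dvdz_mul_mod 4 (2 * n)) //; last first.
    by apply/dvdnP; exists (m./2 * n)%N; rewrite {1}m2; lia.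
  (* With r the remainder of j, 4 divides m r iff (m/2) r is even, which decides the sign. *)
  rewrite -signr_odd {2}m2 -mulnA mulnCA.
  have -> u : (4 %| 2 * u)%N = ~~ odd u by lia.
  by case: (odd _); rewrite ?expr1 ?expr0.
clearbody two_m four_mj n_mi n_mj.
by case: two_m four_mj n_mi n_mj => [] [] [] [];
  split=> //= _; rewrite ?addr0 ?add0r ?subrr.
Qed.
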